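(* Every locally Lipschitz continuous (LLC) system is an either-sided locally Lipschitz continuous (ELLC) system. That is, let $f=(f_1,\dots,f_{n_x}):\mathcal Z\subset\mathbb R^{n_z}\to\mathbb R^{n_x}$ be such that for all $z\in\mathcal Z$ there exist an open neighborhood $\mathcal N_z$ of $z$ and $\rho\ge0$ with $\|f(z')-f(z'')\|_2\le\rho\|z'-z''\|_2$ for all $z',z''\in\mathcal N_z$. Then $f$ is ELLC at every $z\in\mathcal Z$.
   Context: $f$ is the vector field of a system $x_t^+=f(z_t)$ (discrete- or continuous-time). $f$ is ELLC at $z\in\mathcal Z$ if there exists an open neighborhood $\mathcal N_z\subset\mathcal Z$ of $z$ and, for all $i\in\{1,\dots,n_x\}$, there exist a vector $\kappa_i=(\kappa_{i1},\dots,\kappa_{in_z})\in\mathbb R^{n_z}$ with all entries nonzero and a constant $\rho_i\in\mathbb R$ such that for all $z',z''\in\mathcal N_z$, $$\langle\kappa_i(f_i(z')-f_i(z'')),\,z'-z''\rangle\le\rho_i\|z'-z''\|_2^2\qquad\text{for all } i\in\{1,\dots,n_x\}.$$ Neighborhoods are understood within $\mathcal Z$. *)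

(* Defs.v *)
From mathcomp Require Import all_boot all_order all_algebra.
From mathcomp Require Import all_classical all_reals all_analysis.
Set Implicit Arguments.
Unset Strict Implicit.
Unset Printing Implicit Defensive.
Import Order.TTheory GRing.Theory Num.Theory.
Import numFieldNormedType.Exports.
Local Open Scope classical_set_scope.
Local Open Scope ring_scope.

Definition inner (R : realType) (n : nat) (u v : 'cV[R]_n) : R :=
  \sum_(i < n) u i ord0 * v i ord0.

(* The library norm on matrices is the sup norm (it induces the same topology). *)
Definition norm2 (R : realType) (n : nat) (v : 'cV[R]_n) : R :=
  Num.sqrt (\sum_(i < n) v i ord0 ^+ 2).

(* [N] is an open neighborhood of [z] within [Z].  A subset of the carrier of
   [subspace Z] is open as soon as its trace on [Z] is relatively open, hence
   the separate inclusion [N `<=` Z]. *)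
Definition open_nbhs_within (R : realType) (n : nat) (Z : set 'cV[R]_n)
    (z : 'cV[R]_n) (N : set 'cV[R]_n) : Prop :=
  N `<=` Z /\ open_nbhs (z : subspace Z) (N : set (subspace Z)).

(* A map [f : Z -> R^nx] is given by a total function; only its values on [Z]
   matter below. *)
Definition LLC_at (R : realType) (nz nx : nat) (Z : set 'cV[R]_nz)
    (f : 'cV[R]_nz -> 'cV[R]_nx) (z : 'cV[R]_nz) : Prop :=
  exists N : set 'cV[R]_nz, open_nbhs_within Z z N /\
  exists2 rho : R, 0 <= rho &
    forall z' z'', N z' -> N z'' ->
      norm2 (f z' - f z'') <= rho * norm2 (z' - z'').

Definition ELLC_at (R : realType) (nz nx : nat) (Z : set 'cV[R]_nz)
    (f : 'cV[R]_nz -> 'cV[R]_nx) (z : 'cV[R]_nz) : Prop :=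
  exists N : set 'cV[R]_nz, open_nbhs_within Z z N /\
  forall i : 'I_nx, exists (kappa : 'cV[R]_nz) (rho : R),
    (forall j : 'I_nz, kappa j ord0 != 0) /\
    forall z' z'', N z' -> N z'' ->
      inner ((f z' i ord0 - f z'' i ord0) *: kappa) (z' - z'')
        <= rho * norm2 (z' - z'') ^+ 2.

(* Main.v *)
(** Take every [kappa_i] to be the all-ones vector.  A coordinate is bounded in
    absolute value by the Euclidean norm, so with a Lipschitz constant [rho] on
    the neighborhood the constant [rho_i := rho * n_z] works. *)
Require Import Defs.
From mathcomp Require Import all_boot all_order all_algebra.
From mathcomp Require Import all_classical all_reals all_analysis.
Import Order.TTheory GRing.Theory Num.Theory.
Import numFieldNormedType.Exports.
Local Open Scope classical_set_scope.
Local Open Scope ring_scope.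

Lemma norm_coord_le_norm2 (R : realType) (n : nat) (v : 'cV[R]_n) (i : 'I_n) :
  `|v i ord0| <= norm2 v.
Proof.
rewrite /norm2 -sqrtr_sqr ler_wsqrtr// (bigD1 i)//= lerDl.
by apply: sumr_ge0 => j _; exact: sqr_ge0.
Qed.

(** The inner product is [c] times the sum of the [n] coordinates of [v], each at most [norm2 v] in
    absolute value. *)
Lemma norm_inner_const_le (R : realType) (n : nat) (c : R) (v : 'cV[R]_n) :
  `|inner (c *: const_mx 1) v| <= `|c| * (norm2 v *+ n).
Proof.
have -> : inner (c *: const_mx 1) v = c * \sum_(j < n) v j ord0.
  rewrite /inner mulr_sumr; apply: eq_bigr => j _.
  by rewrite !mxE mulr1.
rewrite normrM ler_wpM2l// (le_trans (ler_norm_sum _ _ _))//.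
rewrite -[n in norm2 v *+ n]card_ord -sumr_const.
by apply: ler_sum => j _; exact: norm_coord_le_norm2.
Qed.

Theorem proposition7 (R : realType) (nz nx : nat) (Z : set 'cV[R]_nz)
    (f : 'cV[R]_nz -> 'cV[R]_nx) :
  (forall z : 'cV[R]_nz, Z z -> LLC_at Z f z) ->
  forall z : 'cV[R]_nz, Z z -> ELLC_at Z f z.
Proof.
move=> fL z /fL [N [Nz [rho rho0 fN]]]; exists N; split=> // i.
exists (const_mx 1), (rho *+ nz); split=> [j|z' z'' Nz' Nz''].
  by rewrite mxE oner_eq0.
apply: le_trans (ler_norm _) _; apply: le_trans (norm_inner_const_le _ _ _ _) _.
(* Cancelling the multiple [nz] leaves the alternative [nz = 0]; the other one holds in every case.
   Dropping one factor [norm2 (z' - z'')] then reduces it to the Lipschitz bound for coordinate [i]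
   of [f]. *)
rewrite mulrnAr mulrnAl lerMn2r expr2 mulrA; apply/orP; right.
rewrite ler_wpM2r ?sqrtr_ge0// (le_trans _ (fN _ _ Nz' Nz''))//.
by have := norm_coord_le_norm2 _ _ (f z' - f z'') i; rewrite !mxE.
Qed.
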